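(* Let $C>0$, $C'>0$ and $n\geq\mathrm{e}^{C/8}M\log M$, and draw the entries of an $M\times n$ matrix $\Phi=\{\varphi_i\}_{i=1}^n$ independently from $\mathbb{C}\mathcal{N}(0,\frac1M)$. Given $x\in\mathbb{C}^M\setminus\{0\}$, consider $z_i:=|\langle x,\varphi_i\rangle|^2+\nu_i$, $i=1,\dots,n$, where the real noise vector $\nu=\{\nu_i\}_{i=1}^n$ satisfies $\frac{\|\nu\|}{\|x\|^2}\leq\frac{C'}{\sqrt{M}}$. Let $\beta:=3\mathrm{e}^{-C/8}$. Then with overwhelming probability, \[ \#\Big\{i:\ z_i>\frac{2C}{M}\|x\|^2\Big\}<2\beta n . \]
   Context: $\mathbb{C}\mathcal{N}(0,\sigma^2)$ is the complex Gaussian with independent $\mathcal{N}(0,\sigma^2/2)$ real and imaginary parts. ''With overwhelming probability'' means with probability tending to $1$ exponentially fast as $M\to\infty$ (probability at least $1-c_0\mathrm{e}^{-c_1M}$ for constants $c_0,c_1>0$), for $M$ sufficiently large. *)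

(* Defs.v *)
From HB Require Import structures.
From mathcomp Require Import all_boot all_order all_algebra.
From mathcomp Require Import all_classical all_reals all_analysis.
From mathcomp Require Import complex.
Set Implicit Arguments. Unset Strict Implicit. Unset Printing Implicit Defensive.
Import Order.TTheory GRing.Theory Num.Theory.
Local Open Scope classical_set_scope.
Local Open Scope ring_scope.

(* Mutual independence of a finite family of real random variables:
   the product rule for every family of Borel sets (taking B i = setT
   recovers every subfamily). *)
Definition mutually_independent {R : realType} {d} {T : measurableType d}
  (P : probability T R) (I : finType) (X : I -> {RV P >-> R}) : Prop :=
  forall B : I -> set R, (forall i, measurable (B i)) ->
    P (\bigcap_(i in [set: I]) (X i @^-1` B i)) =
    (\prod_(i : I) P (X i @^-1` B i))%E.

(* X has law N(m, s^2) (s = standard deviation). *)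
Definition has_normal_law {R : realType} {d} {T : measurableType d}
  (P : probability T R) (X : {RV P >-> R}) (m s : R) : Prop :=
  forall B : set R, measurable B -> P (X @^-1` B) = normal_prob m s B.

Definition cplx {R : realType} {d} {T : measurableType d}
  (P : probability T R) (Xre Xim : {RV P >-> R}) (w : T) : R[i] :=
  Complex (Xre w) (Xim w).

Definition cabs2 {R : realType} (z : R[i]) : R := complex.Re z ^+ 2 + complex.Im z ^+ 2.

Definition cinner {R : realType} (M : nat) (x y : 'I_M -> R[i]) : R[i] :=
  \sum_(j < M) x j * complex.conjc (y j).

Definition cnorm2 {R : realType} (M : nat) (x : 'I_M -> R[i]) : R :=
  \sum_(j < M) cabs2 (x j).
Definition rnorm {R : realType} (n : nat) (v : 'I_n -> R) : R :=
  Num.sqrt (\sum_(i < n) v i ^+ 2).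

(* Main.v *)
(** If the noise exceeds [C/M * |x|^2] at [k] indices then
    [k * (C/M)^2 * |x|^4 <= |nu|^2], so [k <= (C'/C)^2 * M], which is at most
    [beta * n / 3] for large [M]. When [2 * beta > 1] the claim is trivial.
    Otherwise it remains to bound the number of [i] with
    [|<x, phi_i>|^2 > C/M * |x|^2]. For such an [i] one of the four real Gaussians
    [+-Re <x, phi_i>], [+-Im <x, phi_i>], rescaled by a suitable [lam], exceeds
    [C]; hence, [L] ranging over these four rescaled Gaussians, the product over
    [i] of [1 + sum_L exp (L - C)] is at least [2 ^ count]. By independence its
    mean is [(1 + 4 exp (- C / 2)) ^ n], and Markov's inequality concludes. *)

Require Import Defs.
From HB Require Import structures.
From mathcomp Require Import all_boot all_order all_algebra finmap.
From mathcomp Require Import all_classical all_reals all_analysis.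
From mathcomp Require Import complex.
From mathcomp Require Import measurable_realfun ring lra.
Import Order.TTheory GRing.Theory Num.Theory.
Local Open Scope classical_set_scope.
Local Open Scope ring_scope.

(** * Integration against a measure known through a density *)

Section integral_density.
Context {R : realType} {d d' : measure_display}.
Context {T : measurableType d} {T' : measurableType d'}.
Variables (mu : {measure set T -> \bar R}) (nu : {measure set T' -> \bar R}).
Variables (Y : T -> T') (g : T -> R).
Hypotheses (mY : measurable_fun setT Y) (mg : measurable_fun setT g).
Hypothesis g0 : forall t, 0 <= g t.
Hypothesis nuE : forall B, measurable B ->
  (\int[mu]_t (g t * \1_B (Y t))%:E = nu B)%E.

Import HBNNSimple.

(** The hypothesis [nuE] is the case of indicators; linearity gives simple functions and monotone
    convergence gives the rest. It is applied once with [g] a product of the remaining independent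
    factors, and once with [g] the normal density and [Y] the identity. *)
Lemma ge0_integral_density (f : T' -> R) :
  measurable_fun setT f -> (forall y, 0 <= f y) ->
  (\int[mu]_t (g t * f (Y t))%:E = \int[nu]_y (f y)%:E)%E.
Proof.
move=> mf f0.
have /measurable_EFinP mEf := mf.
pose h := nnsfun_approx measurableT mEf.
have hf y : (h n y)%:E @[n --> \oo] --> (f y)%:E.
  by apply: (@cvg_nnsfun_approx _ _ _ _ measurableT _ mEf) => // x _; rewrite lee_fin.
have ndh y m n : (m <= n)%N -> h m y <= h n y.
  by move=> mn; exact/lefP/nd_nnsfun_approx.
have mhY n : measurable_fun setT (fun t => g t * h n (Y t)).
  by apply: measurable_funM => //; apply: measurableT_comp.
have -> : (\int[nu]_y (f y)%:E =
    limn (fun n => \int[nu]_y (h n y)%:E))%E.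
  rewrite -monotone_convergence//.
  - by apply: eq_integral => y _; apply/esym/cvg_lim => //; exact: hf.
  - by move=> n; exact/measurable_EFinP.
  - by move=> n y _; rewrite lee_fin.
  - by move=> y _ m n mn; rewrite lee_fin ndh.
have -> : (\int[mu]_t (g t * f (Y t))%:E =
    limn (fun n => \int[mu]_t (g t * h n (Y t))%:E))%E.
  rewrite -monotone_convergence//.
  - apply: eq_integral => t _; apply/esym/cvg_lim => //.
    under eq_fun do rewrite EFinM.
    by rewrite EFinM; apply: cvgeZl => //; exact: hf.
  - by move=> n; exact/measurable_EFinP.
  - by move=> n y _; rewrite lee_fin mulr_ge0.
  - by move=> y _ m n mn; rewrite lee_fin ler_wpM2l// ndh.
congr (limn _); apply/funext => n.
pose s := fset_set (range (h n)).
have s0 i : (i < #|` s|)%N -> 0 <= s`_i.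
  move=> iS; have : s`_i \in s by rewrite mem_nth.
  by rewrite in_fset_set// inE => -[y _ <-].
have mh y : measurable (h n @^-1` [set y]) by exact: measurable_funPTI.
(* Both integrals of the simple function [h n] reduce to this sum over its finitely many values. *)
transitivity (\sum_(i < #|` s|) (s`_i)%:E * nu (h n @^-1` [set s`_i]))%E.
  under eq_integral => t _ do rewrite fimfunEord mulr_sumr -sumEFin.
  rewrite ge0_integral_sum//.
  - apply: eq_bigr => i _; rewrite -nuE//.
    under eq_integral => t _ do rewrite mulrCA EFinM.
    rewrite ge0_integralZl_EFin//; last exact: s0.
    + by move=> t _; rewrite lee_fin mulr_ge0.
    + apply/measurable_EFinP/measurable_funM => //.
      by apply: measurableT_comp.
  - move=> i; apply/measurable_EFinP/measurable_funM => //.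
    by apply: measurable_funM => //; apply: measurableT_comp.
  - by move=> i t _; rewrite lee_fin mulr_ge0// mulr_ge0// s0.
under [RHS]eq_integral => y _ do rewrite fimfunEord -sumEFin.
rewrite ge0_integral_sum//.
- apply: eq_bigr => i _.
  under eq_integral => t _ do rewrite EFinM.
  rewrite ge0_integralZl_EFin//; last exact: s0.
  + by rewrite integral_indic// setIT.
  + exact/measurable_EFinP.
- by move=> i; apply/measurable_EFinP/measurable_funM.
- by move=> i t _; rewrite lee_fin mulr_ge0// s0.
Qed.
End integral_density.

(** * Expectations of products of independent variables *)

Section expectation_independent.
Context {R : realType} {d : measure_display} {T : measurableType d}.
Variables (P : probability T R) (I : finType) (X : I -> {RV P >-> R}).
Hypothesis indepX : mutually_independent X.

Let probability_integral (A : set T) : measurable A ->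
  P A = (\int[P]_t (\1_A t)%:E)%E.
Proof. by move=> mA; rewrite integral_indic// setIT. Qed.

Lemma ge0_expectation_prod (f : I -> R -> R) (m : I -> R) :
  (forall k, measurable_fun setT (f k)) -> (forall k y, 0 <= f k y) ->
  (forall k, (\int[P]_t (f k (X k t))%:E = (m k)%:E)%E) ->
  (\int[P]_t (\prod_k f k (X k t))%:E = (\prod_k m k)%:E)%E.
Proof.
(* Form suited to induction: [f k] is arbitrary for [k] in [s] and an indicator elsewhere. For empty
   [s] this is the definition of independence. *)
suff step (s : seq I) : forall (f : I -> R -> R) (m : I -> R),
  (forall k, measurable_fun setT (f k)) -> (forall k y, 0 <= f k y) ->
  (forall k, (\int[P]_t (f k (X k t))%:E = (m k)%:E)%E) ->
  (forall k, k \notin s -> exists2 B, measurable B & f k = \1_B) ->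
  (\int[P]_t (\prod_k f k (X k t))%:E = (\prod_k m k)%:E)%E.
  move=> mf f0 fm; apply: (step (enum I)) => // k.
  by rewrite mem_enum.
elim: s => [|k s IH] {}f {}m mf f0 fm fB.
  have /choice[B BP] k : exists B, measurable B /\ f k = \1_B.
    by have [//|B mB ->] := fB k; exists B.
  have mXB k : measurable (X k @^-1` B k).
    by apply: measurable_funPTI; exact: (BP k).1.
  have PB k : P (X k @^-1` B k) = (m k)%:E.
    by rewrite -fm (BP k).2 probability_integral.
  transitivity (P (\bigcap_(k in [set: I]) (X k @^-1` B k))).
    rewrite probability_integral; last first.
      by apply: fin_bigcap_measurable => // k _.
    apply: eq_integral => t _; congr EFin; rewrite indicE.
    have [tB|tB] := boolP (t \in _).
      rewrite big1// => k _; rewrite (BP k).2 indicE mem_set//.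
      by move/set_mem: tB => /(_ k Logic.I).
    move: tB => /negP tB.
    have [k Bk] : exists k, ~ B k (X k t).
      by apply/existsNP => Bt; apply: tB; apply/mem_set => k _; exact: Bt.
    by rewrite (bigD1 k)//= (BP k).2 indicE memNset// mul0r.
  rewrite indepX; last by move=> k; exact: (BP k).1.
  by rewrite -prodEFin; apply: eq_bigr => k _.
have [ks|ks] := boolP (k \in s).
  by apply: IH => // j js; apply: fB; rewrite inE negb_or js andbT; apply: contraNneq js => ->.
pose c := \prod_(j | j != k) m j.
have m0 j : 0 <= m j.
  by rewrite -lee_fin -fm; apply: integral_ge0 => t _; rewrite lee_fin.
have c0 : 0 <= c by apply: prodr_ge0.
pose g t := \prod_(j | j != k) f j (X j t).
have mg : measurable_fun setT g.
  rewrite /g; under eq_fun do rewrite -big_filter.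
  by apply: measurable_prod => j _; apply: measurableT_comp.
have g0 t : 0 <= g t by apply: prodr_ge0.
(* Replacing [f k] by the indicator of [B] puts the product within reach of [IH]. Letting [B] vary,
   this says that [g] acts as a density yielding [c] times the law of [X k], so
   [ge0_integral_density] can restore the original [f k]. *)
have gE B : measurable B ->
    (\int[P]_t (g t * \1_B (X k t))%:E = mscale (NngNum c0) (distribution P (X k)) B)%E.
  move=> mB.
  pose f' := [eta f with k |-> \1_B]; pose m' := [eta m with k |-> fine (P (X k @^-1` B))].
  have mXB : measurable (X k @^-1` B) by exact: measurable_funPTI.
  have := IH f' m' _ _ _ _; rewrite (bigD1 k)//= eqxx.
  rewrite /mscale/= /distribution/= /pushforward.
  have -> : \prod_(i | i != k) (if i == k then fine (P (X k @^-1` B)) else m i) = c.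
    by apply: eq_bigr => i /negPf ->.
  rewrite EFinM fineK ?fin_num_measure// muleC => <-.
  - apply: eq_integral => t _; congr EFin; rewrite (bigD1 k)//= eqxx mulrC; congr (_ * _).
    by apply: eq_bigr => i /negPf ->.
  - by move=> j; rewrite /f'/=; case: eqP => // _; exact: measurable_indic.
  - by move=> j y; rewrite /f'/=; case: eqP.
  - move=> j; rewrite /f' /m' /=; case: eqP => [->|//].
    by rewrite fineK ?fin_num_measure// probability_integral.
  - move=> j js; rewrite /f'/=; case: eqP => [_|/eqP jk]; first by exists B.
    by apply: fB; rewrite inE negb_or jk.
rewrite (bigD1 k)//= mulrC EFinM.
under eq_integral => t _ do rewrite (bigD1 k)//= mulrC -/(g t).
rewrite (ge0_integral_density _ _ _ _ _ mg g0 gE)//.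
rewrite ge0_integral_mscale//=; last 2 first.
- exact/measurable_EFinP.
- by move=> y _; rewrite lee_fin.
rewrite ge0_integral_distribution ?fm//.
- exact/measurable_EFinP.
- by move=> y; rewrite lee_fin.
Qed.

End expectation_independent.

(** * Exponential moments of Gaussians and Markov's inequality *)

(** Completing the square: [expR (a * y)] times the density of mean [0] is the constant on the right
    times the density of mean [a * s ^+ 2], which integrates to [1]. *)
Lemma integral_expR_normal {R : realType} {d : measure_display}
    {T : measurableType d} (P : probability T R) (X : {RV P >-> R}) (s a : R) :
  s != 0 -> has_normal_law X 0 s ->
  (\int[P]_t (expR (a * X t))%:E = (expR (a ^+ 2 * s ^+ 2 / 2))%:E)%E.
Proof.
move=> s0 hX.
have mexp : measurable_fun setT (fun y : R => expR (a * y)).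
  by apply: measurableT_comp.
have nE B : measurable B -> (\int[@lebesgue_measure R]_y
    (normal_pdf 0 s y * \1_B y)%:E = distribution P X B)%E.
  move=> mB; rewrite /distribution/= /pushforward hX// /normal_prob.
  rewrite [RHS]integral_mkcond/=; apply: eq_integral => y _.
  by rewrite patchE indicE; case: ifP => _; rewrite ?mulr1 ?mulr0.
transitivity (\int[distribution P X]_y (expR (a * y))%:E)%E.
  rewrite ge0_integral_distribution//; first exact/measurable_EFinP.
rewrite -(ge0_integral_density (@lebesgue_measure R) (distribution P X) id
  _ _ (measurable_normal_pdf 0 s) (normal_pdf_ge0 0 s) nE)//.
transitivity (\int[@lebesgue_measure R]_y
    ((expR (a ^+ 2 * s ^+ 2 / 2))%:E * (normal_pdf (a * s ^+ 2) s y)%:E))%E.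
  apply: eq_integral => y _; rewrite -EFinM; congr EFin.
  rewrite !normal_pdfE// -[LHS]mulrA [RHS]mulrCA; congr (_ * _).
  rewrite /normal_fun -!expRD; congr expR.
  by field.
rewrite ge0_integralZl_EFin//; last 2 first.
- by move=> y _; rewrite lee_fin normal_pdf_ge0.
- by apply/measurable_EFinP; exact: measurable_normal_pdf.
by rewrite integral_normal_pdf mule1.
Qed.

Lemma ge0_markov_set {R : realType} {d : measure_display}
    {T : measurableType d} (P : probability T R) (A : set T) (Z : T -> R)
    (c : R) :
  measurable A -> measurable_fun setT Z -> (forall t, 0 <= Z t) -> 0 <= c ->
  (forall t, A t -> c <= Z t) -> (c%:E * P A <= \int[P]_t (Z t)%:E)%E.
Proof.
move=> mA mZ Z0 c0 AZ.
rewrite -[A in P A]setIT -(@integral_indic _ T _ P)//.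
rewrite -ge0_integralZl_EFin//; last exact/measurable_EFinP.
apply: ge0_le_integral => //.
- by move=> t _; rewrite mule_ge0.
- apply: measurable_funeM; exact/measurable_EFinP.
- exact/measurable_EFinP.
- move=> t _; rewrite -EFinM lee_fin indicE.
  by have [/set_mem/AZ|_] := boolP (t \in A); rewrite ?mulr1 ?mulr0.
Qed.

(* Expanding the product over blocks into a sum over choice functions leaves
   only exponentials of linear combinations, so no block independence is
   needed. *)
Lemma integral_prod_sum_expR {R : realType} {d : measure_display}
    {T : measurableType d} (P : probability T R) (I K O : finType)
    (X : K -> {RV P >-> R}) (s : R) (blk : K -> I) (wt : O -> R)
    (co : O -> K -> R) :
  mutually_independent X -> s != 0 -> (forall k, has_normal_law (X k) 0 s) ->
  (forall o, 0 <= wt o) ->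
  (\int[P]_t (\prod_i \sum_o wt o *
       \prod_(k | blk k == i) expR (co o k * X k t))%:E =
   (\prod_i \sum_o wt o *
       \prod_(k | blk k == i) expR (co o k ^+ 2 * s ^+ 2 / 2))%:E)%E.
Proof.
move=> indepX s0 hX wt0.
(* Abstracting over [h] lets one expansion serve twice: for the random exponentials and for their
   means. *)
pose F (h : K -> O -> R) := \prod_i \sum_o wt o * \prod_(k | blk k == i) h k o.
have FE h : F h = \sum_(f : {ffun I -> O})
    (\prod_i wt (f i)) * \prod_k h k (f (blk k)).
  rewrite /F bigA_distr_bigA/=; apply: eq_bigr => f _.
  rewrite big_split/=; congr (_ * _).
  (* Each [k] lies in exactly one block, so the products over blocks merge into one product over all
     [k], with the choice read off at [blk k]. *)
  rewrite [RHS](partition_big blk xpredT)//=; apply: eq_bigr => i _.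
  by apply: eq_bigr => k /eqP ->.
under eq_integral => t _.
  rewrite [X in X%:E](FE (fun k o => expR (co o k * X k t))) -sumEFin; over.
rewrite [X in _ = X%:E](FE (fun k o => expR (co o k ^+ 2 * s ^+ 2 / 2))).
have mE f : measurable_fun setT (fun t => (\prod_k expR (co (f (blk k)) k * X k t))).
  apply: measurable_prod => k _; apply: measurableT_comp => //.
  exact: measurable_funM.
have E0 (f : {ffun I -> O}) t : 0 <= \prod_k expR (co (f (blk k)) k * X k t).
  by apply: prodr_ge0 => k _; exact: expR_ge0.
have W0 (f : {ffun I -> O}) : 0 <= \prod_i wt (f i) by exact: prodr_ge0.
rewrite ge0_integral_sum//; last 2 first.
- by move=> f; apply/measurable_EFinP/measurable_funM.
- by move=> f t _; rewrite lee_fin mulr_ge0.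
rewrite -sumEFin; apply: eq_bigr => f _.
under eq_integral => t _ do rewrite EFinM.
rewrite ge0_integralZl_EFin//; last 2 first.
- by move=> t _; rewrite lee_fin.
- exact/measurable_EFinP.
rewrite EFinM; congr (_ * _)%E.
apply: (ge0_expectation_prod _ _ _ indepX (fun k y => expR (co (f (blk k)) k * y))).
- by move=> k; apply: measurableT_comp.
- by move=> k y; exact: expR_ge0.
- by move=> k; exact: integral_expR_normal.
Qed.

(** * Real form of the measurements and counting estimates *)

(** The real and imaginary parts become real linear forms in the coordinates [u], [v], each with a
    coefficient vector of squared norm [cnorm2 x]. *)
Lemma cabs2_cinner {R : realType} (M : nat) (x : 'I_M -> R[i])
    (u v : 'I_M -> R) :
  cabs2 (cinner x (fun j => Complex (u j) (v j))) =
  (\sum_j (complex.Re (x j) * u j + complex.Im (x j) * v j)) ^+ 2 +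
  (\sum_j (complex.Im (x j) * u j - complex.Re (x j) * v j)) ^+ 2.
Proof.
rewrite /cabs2 /cinner !raddf_sum/=; congr (_ ^+ 2 + _ ^+ 2); apply: eq_bigr => j _;
by case: (x j) => a b /=; ring.
Qed.

Lemma cnorm2_gt0 {R : realType} (M : nat) (x : 'I_M -> R[i]) :
  x != (fun _ => 0) -> 0 < cnorm2 x.
Proof.
have x0 j : 0 <= cabs2 (x j) by rewrite addr_ge0 ?sqr_ge0.
move=> xN0; rewrite lt_neqAle sumr_ge0// andbT; apply: contra xN0 => /eqP/esym.
move=> /eqP; rewrite psumr_eq0// => /allP xE; apply/eqP/funext => j.
have := xE j (mem_index_enum _); rewrite /= /cabs2 paddr_eq0 ?sqr_ge0//.
by rewrite !sqrf_eq0; case: (x j) => a b /= /andP[/eqP -> /eqP ->].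
Qed.

(** Chebyshev's argument: each counted index contributes at least [a ^+ 2] to the squared norm. *)
Lemma card_sq_lt {R : realType} (n : nat) (nu : 'I_n -> R) (a : R) : 0 <= a ->
  #|[pred i | a < nu i]|%:R * a ^+ 2 <= rnorm nu ^+ 2.
Proof.
move=> a0; rewrite sqr_sqrtr; last by apply: sumr_ge0 => i _; exact: sqr_ge0.
rewrite -sum1_card natr_sum mulr_suml [leRHS](bigID [pred i | a < nu i])/=.
rewrite -[leLHS]addr0; apply: lerD; last by apply: sumr_ge0 => i _; exact: sqr_ge0.
apply: ler_sum => i ai; rewrite mul1r lerXn2r ?nnegrE//; last exact: ltW.
exact: le_trans (ltW ai).
Qed.

(** This spends the factor [2] of the threshold: one half is allotted to the signal, the other to
    the noise. *)
Lemma card_add_lt {R : realType} (n : nat) (q nu : 'I_n -> R) (a : R) :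
  (#|[pred i | (2 * a < q i + nu i)%R]| <=
   #|[pred i | (a < q i)%R]| + #|[pred i | (a < nu i)%R]|)%N.
Proof.
rewrite -cardUI; apply: leq_trans (leq_addr _ _); apply/subset_leq_card/fintype.subsetP => i.
rewrite !inE => h; rewrite -(negbK (a < q i)) -(negbK (a < nu i)) -negb_and -!leNgt.
by apply/negP => /andP[? ?]; move: h; rewrite ltNge => /negP; apply; lra.
Qed.

(** One of [u], [- u], [v], [- v] must reach [c], since otherwise both squares are at most [c ^+ 2];
    its exponential alone is at least [1]. *)
Lemma sum_exp_signs_ge1 {R : realType} (c u v : R) : 0 <= c ->
  2 * c ^+ 2 < u ^+ 2 + v ^+ 2 ->
  1 <= expR (u - c) + expR (- u - c) + expR (v - c) + expR (- v - c).
Proof.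
move=> c0 h.
have p (y : R) : 0 <= y -> 1 <= expR y by move=> y0; rewrite -expR0 ler_expR.
have := expR_ge0 (u - c); have := expR_ge0 (- u - c).
have := expR_ge0 (v - c); have := expR_ge0 (- v - c).
case: (leP c u) => [cu|uc].
  by have := p (u - c); rewrite subr_ge0 => /(_ cu); lra.
case: (leP c (- u)) => [cu|uc'].
  by have := p (- u - c); rewrite subr_ge0 => /(_ cu); lra.
case: (leP c v) => [cu|vc].
  by have := p (v - c); rewrite subr_ge0 => /(_ cu); lra.
case: (leP c (- v)) => [cu|vc'].
  by have := p (- v - c); rewrite subr_ge0 => /(_ cu); lra.
exfalso; have : u ^+ 2 <= c ^+ 2 by nra.
have : v ^+ 2 <= c ^+ 2 by nra.
by move: h; lra.
Qed.

Lemma measurable_card_lt {R : realType} {d : measure_display}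
    {T : measurableType d} (I : finType) (q : I -> T -> R) (a b : R) :
  (forall i, measurable_fun setT (q i)) ->
  measurable [set t | #|[pred i | a < q i t]|%:R < b].
Proof.
move=> mq.
have mA i : measurable [set t | a < q i t].
  rewrite -[X in measurable X]setTI.
  exact: (measurable_fun_ltr (measurable_cst a) (mq i)).
pose cnt t : R := \sum_i \1_[set t | a < q i t] t.
have cntE t : #|[pred i | a < q i t]|%:R = cnt t.
  rewrite -sum1_card natr_sum big_mkcond/=; apply: eq_bigr => i _.
  by rewrite inE indicE; case: ifPn => [h|/negP h]; [rewrite mem_set|rewrite memNset].
have mcnt : measurable_fun setT cnt.
  by apply: measurable_sum => i; exact: measurable_indic.
under eq_set do rewrite cntE.
rewrite -[X in measurable X]setTI.
exact: (measurable_fun_ltr mcnt (measurable_cst b)).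
Qed.

(** Block [i] collects the real ([true]) and imaginary ([false]) coordinates of the [i]-th
    measurement vector. *)
Lemma sum_block {R : realType} (M n : nat) (i : 'I_n)
    (F : 'I_M * 'I_n * bool -> R) :
  \sum_(k | k.1.2 == i) F k = \sum_j (F (j, i, true) + F (j, i, false)).
Proof.
transitivity (\sum_j \sum_(i' | i' == i) \sum_b F (j, i', b)); last first.
  by apply: eq_bigr => j _; rewrite big_pred1_eq big_bool.
rewrite !pair_big_dep/=; apply: eq_big => [[[j i'] b]|[[j i'] b]] //=.
by rewrite andbT.
Qed.

Lemma sum_option_bool2 {R : realType} (F : option (bool * bool) -> R) :
  \sum_o F o = F None +
    (F (Some (true, false)) + F (Some (true, true)) +
     F (Some (false, false)) + F (Some (false, true))).
Proof.
rewrite (bigD1 None)// (bigD1 (Some (true, false)))//.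
rewrite (bigD1 (Some (true, true)))// (bigD1 (Some (false, false)))//.
rewrite (bigD1 (Some (false, true)))//= big1; first by rewrite addr0 !addrA.
by move=> [[[] []]|].
Qed.

(** This is [card_sq_lt] at [a = C / M * N]: the factor [N ^+ 2] cancels and
    [(C' ^+ 2 / M) / (C / M) ^+ 2] leaves the bound. *)
Lemma card_large_noise {R : realType} (M n : nat) (C C' N : R)
    (nu : 'I_n -> R) : 0 < C -> 0 < C' -> 0 < N -> 0 < M%:R :> R ->
  rnorm nu / N <= C' / Num.sqrt M%:R ->
  #|[pred i | C / M%:R * N < nu i]|%:R <= C' ^+ 2 / C ^+ 2 * M%:R.
Proof.
move=> hC hC' N0 M0 hnu.
have a0 : 0 < C / M%:R * N by rewrite mulr_gt0// divr_gt0.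
have := card_sq_lt _ nu _ (ltW a0); rewrite -ler_pdivlMr ?exprn_gt0//.
move=> /le_trans; apply; rewrite ler_pdivrMr ?exprn_gt0//.
have -> : C' ^+ 2 / C ^+ 2 * M%:R * (C / M%:R * N) ^+ 2 =
    (C' / Num.sqrt M%:R * N) ^+ 2.
  rewrite [in RHS]exprMn [in RHS]expr_div_n sqr_sqrtr ?(ltW M0)//.
  by field; rewrite !gt_eqF.
rewrite lerXn2r ?nnegrE ?sqrtr_ge0//; last by rewrite -ler_pdivrMr.
by rewrite mulr_ge0 ?divr_ge0 ?sqrtr_ge0// ltW.
Qed.

(** * Chernoff bound for the number of large measurements *)

Section gaussian_measurements.
Context {R : realType} {d : measure_display} {T : measurableType d}.
Variables (P : probability T R) (M n : nat) (x : 'I_M -> R[i]).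
Variables (Phi_re Phi_im : 'I_M -> 'I_n -> {RV P >-> R}).
Let q i w := cabs2 (cinner x (fun j => cplx (Phi_re j i) (Phi_im j i) w)).
Let A i w :=
  \sum_j (complex.Re (x j) * Phi_re j i w + complex.Im (x j) * Phi_im j i w).
Let B i w :=
  \sum_j (complex.Im (x j) * Phi_re j i w - complex.Re (x j) * Phi_im j i w).

Let qE i w : q i w = A i w ^+ 2 + B i w ^+ 2.
Proof. exact: cabs2_cinner. Qed.

Lemma measurable_cabs2_cinner i : measurable_fun setT (q i).
Proof.
rewrite (_ : q i = fun w => A i w ^+ 2 + B i w ^+ 2); last exact/funext/qE.
apply: measurable_funD; apply: measurable_funX; apply: measurable_sum => j.
  by apply: measurable_funD; apply: measurable_funM.
by apply: measurable_funB; apply: measurable_funM.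
Qed.

(** Markov's inequality for a product [Z] whose mean is the right-hand side and which is at least
    [expR (b / 2)] on [E]. *)
Lemma chernoff_card_cabs2_cinner (C b : R) (E : set T) :
  0 < C -> 0 < M%:R :> R -> x != (fun _ => 0) ->
  mutually_independent (fun k : 'I_M * 'I_n * bool =>
    if k.2 then Phi_re k.1.1 k.1.2 else Phi_im k.1.1 k.1.2) ->
  (forall j i, has_normal_law (Phi_re j i) 0 (Num.sqrt (1 / (2 * M%:R)))) ->
  (forall j i, has_normal_law (Phi_im j i) 0 (Num.sqrt (1 / (2 * M%:R)))) ->
  measurable E ->
  (forall w, E w -> b <= #|[pred i | C / M%:R * cnorm2 x < q i w]|%:R) ->
  ((expR (b / 2))%:E * P E <= ((1 + 4 * expR (- (C / 2))) ^+ n)%:E)%E.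
Proof.
move=> hC M0 xN0 indep hre him mE Eb.
set N := cnorm2 x in Eb *.
have N0 : 0 < N by exact: cnorm2_gt0.
pose X (k : 'I_M * 'I_n * bool) :=
  if k.2 then Phi_re k.1.1 k.1.2 else Phi_im k.1.1 k.1.2.
have hX k : has_normal_law (X k) 0 (Num.sqrt (1 / (2 * M%:R))).
  by rewrite /X; case: k.2.
set s := Num.sqrt _ in hX.
have s2 : s ^+ 2 = 1 / (2 * M%:R).
  by rewrite sqr_sqrtr// divr_ge0// mulr_ge0// ltW.
have sN0 : s != 0 by rewrite gt_eqF// sqrtr_gt0 divr_gt0// mulr_gt0.
(* This scale serves two ends: [lam * A i] and [lam * B i] have variance [C], so [expR (L - C)] has
   mean [expR (- (C / 2))]; and [q i w > C / M * N] becomes [2 * C ^+ 2 < (lam * A i w) ^+ 2 + (lam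
   * B i w) ^+ 2], as [sum_exp_signs_ge1] requires. *)
pose lam := Num.sqrt (2 * C * M%:R / N).
have lam2 : lam ^+ 2 = 2 * C * M%:R / N.
  by rewrite sqr_sqrtr// divr_ge0 ?mulr_ge0// ltW.
pose cf (dir b : bool) (j : 'I_M) := match dir, b with
  | true, true => complex.Re (x j) | true, false => complex.Im (x j)
  | false, true => complex.Im (x j) | false, false => - complex.Re (x j) end.
(* [None] encodes the constant term [1]; in [Some (dir, sgn)], [dir] selects the real or imaginary
   part and [sgn = true] the minus sign. *)
pose co (o : option (bool * bool)) (k : 'I_M * 'I_n * bool) : R :=
  if o is Some (dir, sgn) then (-1) ^+ sgn * lam * cf dir k.2 k.1.1 else 0.
pose wt (o : option (bool * bool)) : R := if o is Some _ then expR (- C) else 1.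
have wt0 o : 0 <= wt o by case: o => [[]|]//=; rewrite expR_ge0.
pose Z w := \prod_i \sum_o wt o *
       \prod_(k : 'I_M * 'I_n * bool | k.1.2 == i) expR (co o k * X k w).
have EZ := integral_prod_sum_expR P _ _ _ X s (fun k => k.1.2) wt co indep sN0 hX wt0.
have linE dir sgn i w : \sum_(k | k.1.2 == i) co (Some (dir, sgn)) k * X k w =
    (-1) ^+ sgn * lam * (if dir then A i w else B i w).
  rewrite sum_block; case: dir; rewrite mulr_sumr; apply: eq_bigr => j _;
  by rewrite /co /X /=; ring.
have varE dir sgn i : \sum_(k | k.1.2 == i) co (Some (dir, sgn)) k ^+ 2 * s ^+ 2 / 2 = C / 2.
  rewrite sum_block (_ : C / 2 = lam ^+ 2 * s ^+ 2 / 2 * N); last first.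
    by rewrite lam2 s2; field; rewrite !gt_eqF.
  rewrite /N /cnorm2 mulr_sumr; apply: eq_bigr => j _.
  by rewrite /co /cabs2 !exprMn -exprM mulnC exprM sqrrN expr1n expr1n mul1r; case: dir => /=; ring.
have {}EZ : (\int[P]_w (Z w)%:E = ((1 + 4 * expR (- (C / 2))) ^+ n)%:E)%E.
  rewrite EZ; congr EFin; rewrite -[in RHS](card_ord n) -prodr_const.
  apply: eq_bigr => i _; rewrite sum_option_bool2.
  rewrite -!expR_sum !varE big1 /wt; last by move=> k _; rewrite /co expr0n/= !mul0r.
  rewrite expR0 mulr1 -!expRD (_ : - C + C / 2 = - (C / 2)); last by field.
  by ring.
have Zi i w : C / M%:R * N < q i w -> 2 <= \sum_o wt o *
    \prod_(k : 'I_M * 'I_n * bool | k.1.2 == i) expR (co o k * X k w).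
  rewrite sum_option_bool2 -!expR_sum !linE big1 /wt; last by move=> k _; rewrite /co mul0r.
  rewrite expR0 mulr1 -!expRD => h; rewrite (_ : 2 = 1 + 1)// lerD2l.
  have := @sum_exp_signs_ge1 _ C (lam * A i w) (lam * B i w) (ltW hC).
  rewrite !exprMn -mulrDr -qE lam2.
  have -> : 2 * C ^+ 2 = 2 * C * M%:R / N * (C / M%:R * N).
    by field; rewrite !gt_eqF.
  rewrite ltr_pM2l; last by rewrite divr_gt0// !mulr_gt0.
  move=> /(_ h); rewrite expr0 expr1 !mul1r !mulN1r !mulNr.
  by rewrite ![- C + _]addrC.
(* The [None] term alone gives [1], so indices that are not counted never shrink the product. *)
have Zi1 i w : 1 <= \sum_o wt o *
    \prod_(k : 'I_M * 'I_n * bool | k.1.2 == i) expR (co o k * X k w).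
  rewrite sum_option_bool2 [X in X + _](_ : _ = 1); last first.
    by rewrite mul1r big1// => k _; rewrite mul0r expR0.
  by rewrite lerDl !addr_ge0// mulr_ge0// prodr_ge0// => k _; exact: expR_ge0.
have Z2 w : expR (#|[pred i | C / M%:R * N < q i w]|%:R / 2) <= Z w.
  rewrite -sum1_card natr_sum mulr_suml expR_sum big_mkcond/=.
  apply: ler_prod => i _; case: ifP => [iq|_]; last by rewrite ler01 Zi1.
  rewrite expR_ge0; apply: le_trans (Zi i w iq); rewrite mul1r.
  (* [1 + y <= expR y] at [y = - 1 / 2] yields [expR (1 / 2) <= 2], so each counted factor is at
     least [expR (1 / 2)]. *)
  have := expR_ge1Dx (- 2^-1 : R); rewrite expRN => h.
  by rewrite -[leRHS]invrK -lef_pV2 ?posrE ?invr_gt0 ?expR_gt0// invrK; apply: le_trans h; lra.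
have mZ : measurable_fun setT Z.
  apply: measurable_prod => i _; apply: measurable_sum => o.
  apply: measurable_funM => //; under eq_fun do rewrite -big_filter.
  by apply: measurable_prod => k _; apply: measurableT_comp => //; apply: measurable_funM.
have Z0 w : 0 <= Z w by apply: le_trans (Z2 w); exact: expR_ge0.
rewrite -EZ; apply: ge0_markov_set => //.
by move=> w /Eb bw; apply: le_trans (Z2 w); rewrite ler_expR ler_pM2r ?invr_gt0.
Qed.

End gaussian_measurements.

Theorem theorem6p11 (R : realType) (C C' : R) (hC : 0 < C) (hC' : 0 < C') :
  exists (c0 c1 : R) (M0 : nat), 0 < c0 /\ 0 < c1 /\
  forall (M n : nat), (M0 <= M)%N ->
  expR (C / 8) * M%:R * ln (M%:R) <= n%:R ->
  forall (x : 'I_M -> R[i]), x != (fun _ => 0) ->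
  forall (nu : 'I_n -> R),
  rnorm nu / cnorm2 x <= C' / Num.sqrt (M%:R) ->
  forall (d : measure_display) (T : measurableType d) (P : probability T R)
         (Phi_re Phi_im : 'I_M -> 'I_n -> {RV P >-> R}),
  mutually_independent (fun k : 'I_M * 'I_n * bool =>
    if k.2 then Phi_re k.1.1 k.1.2 else Phi_im k.1.1 k.1.2) ->
  (forall j i, has_normal_law (Phi_re j i) 0 (Num.sqrt (1 / (2 * M%:R)))) ->
  (forall j i, has_normal_law (Phi_im j i) 0 (Num.sqrt (1 / (2 * M%:R)))) ->
  let beta := 3 * expR (- (C / 8)) in
  ((1 - c0 * expR (- (c1 * M%:R)))%:E <=
   P [set w | (#|[pred i : 'I_n |
        2 * C / M%:R * cnorm2 x <
        cabs2 (cinner x (fun j => cplx (Phi_re j i) (Phi_im j i) w))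
        + nu i]|%:R < 2 * beta * n%:R)%R])%E.
Proof.
(* With [K = C' ^+ 2 / C ^+ 2], this threshold forces [1 + K <= ln M]. For [t = expR (- (C / 8))] it
   follows that [(1 + K) * M <= t * n]: hence [t * n] dominates both the noise count [K * M] and the
   target exponent [M]. *)
exists 1, 1, (Num.truncn (expR (1 + C' ^+ 2 / C ^+ 2))).+1.
split; first exact: ltr01.
split; first exact: ltr01.
move=> M n M0M hn x xN0 nu hnu d T P Phi_re Phi_im indep hre him.
lazy zeta; set beta := 3 * expR _.
set K := C' ^+ 2 / C ^+ 2 in M0M.
have K0 : 0 <= K by rewrite divr_ge0 ?sqr_ge0.
have hM : expR (1 + K) < M%:R.
  by apply: lt_le_trans (truncnS_gt _) _; rewrite ler_nat.
have M0 : 0 < M%:R :> R := lt_trans (expR_gt0 _) hM.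
have lnM : 1 + K <= ln M%:R by rewrite -ler_expR lnK ?posrE// ltW.
pose t := expR (- (C / 8)).
have t0 : 0 < t by exact: expR_gt0.
have tn : (1 + K) * M%:R <= t * n%:R.
  have : t * (expR (C / 8) * M%:R * ln M%:R) <= t * n%:R by rewrite ler_wpM2l// ltW.
  apply: le_trans; rewrite !mulrA /t expRN mulVf ?gt_eqF ?expR_gt0// mul1r.
  by rewrite mulrC ler_wpM2l// ltW.
have n0 : 0 < n%:R :> R.
  rewrite -(pmulr_rgt0 _ t0); apply: lt_le_trans tn.
  by rewrite mulr_gt0// ltr_wpDr.
set N := cnorm2 x.
have N0 : 0 < N by exact: cnorm2_gt0.
pose q i w := cabs2 (cinner x (fun j => cplx (Phi_re j i) (Phi_im j i) w)).
set G := [set w | _].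
have GE : G = [set w | #|[pred i | 2 * C / M%:R * N < q i w + nu i]|%:R < 2 * beta * n%:R] by [].
(* Here [2 * beta = 6 * t]. The nontrivial case keeps [t <= 1 / 6], which later makes [t ^+ 4] small
   against [t]. *)
have [t6|t6] := ltP 1 (6 * t).
  have -> : G = setT.
    apply/seteqP; split => // w _; rewrite GE/=.
    apply: (@le_lt_trans _ _ n%:R).
      by rewrite ler_nat -[leqRHS]card_ord max_card.
    by rewrite ltr_pMl// /beta -/t mulrA; apply: lt_le_trans t6 _; lra.
  by rewrite probability_setT lee_fin gerBl mul1r expR_ge0.
have mG : measurable G.
  rewrite GE; apply: (measurable_card_lt _ (fun i w => q i w + nu i)) => i.
  by apply: measurable_funD => //; exact: measurable_cabs2_cinner.
have noise := card_large_noise _ _ _ _ _ _ hC hC' N0 M0 hnu.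
(* Outside [G] at least [6 * t * n] indices are counted and noise explains at most [t * n] of them;
   the [5 * t * n] left are more than needed. *)
have bad w : (~` G) w ->
    3 * (t * n%:R) <= #|[pred i | C / M%:R * N < q i w]|%:R.
  rewrite GE/= => /negP; rewrite -leNgt => hw.
  have := card_add_lt _ (q ^~ w) nu (C / M%:R * N).
  rewrite -(ler_nat R) natrD !mulrA => hc.
  have KM : K * M%:R <= t * n%:R.
    by apply: le_trans tn; rewrite ler_wpM2r ?(ltW M0)// lerDr.
  have : 6 * (t * n%:R) <= 2 * beta * n%:R by rewrite /beta -/t; lra.
  have : 0 < t * n%:R by rewrite mulr_gt0.
  move: noise; rewrite -/K; lra.
have := chernoff_card_cabs2_cinner _ _ _ _ _ _ _ _ _ hC M0 xN0 indep hre him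
  (measurableC mG) bad.
have fG : P G \is a fin_num by exact: fin_num_measure.
rewrite probability_setC// -(fineK fG) -EFinB -EFinM !lee_fin mul1r mul1r => h.
suff : 1 - fine (P G) <= expR (- M%:R) by lra.
have t4 : expR (- (C / 2)) = t ^+ 4.
  by rewrite -expRM_natl; congr expR; field.
(* From [t <= 1 / 6] comes [4 * t ^+ 4 <= t / 2], so each factor is at most
   [1 + t / 2 <= expR (t / 2)]. *)
have h1 : (1 + 4 * t ^+ 4) ^+ n <= expR (2^-1 * (t * n%:R)).
  rewrite [2^-1 * _]mulrA expRM_natr lerXn2r ?nnegrE ?expR_ge0 ?addr_ge0 ?mulr_ge0 ?exprn_ge0 ?(ltW t0)//.
  apply: le_trans (expR_ge1Dx _); rewrite lerD2l.
  have : t ^+ 3 <= 6^-1 ^+ 3 by rewrite lerXn2r ?nnegrE ?(ltW t0)//; lra.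
  by rewrite [t ^+ 4]exprS; nra.
(* Balance of exponents: [t * n / 2 - 3 * t * n / 2 = - t * n], which is at most [- M]. *)
apply: (@le_trans _ _ (expR (- (t * n%:R)))); last first.
  by rewrite ler_expR lerN2; apply: le_trans tn; rewrite ler_pMl// lerDl.
rewrite -(ler_pM2l (expR_gt0 (3 * (t * n%:R) / 2))) -expRD; apply: le_trans h _.
rewrite t4; apply: le_trans h1 _; rewrite ler_expR; lra.
Qed.
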